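(* For any $G \in \mathcal{C}$ such that $G$ is not a cycle, there exists a vertex $v\in V(G)$ such that $\mathrm{DOM}_t(G-v)$ is defined and $\mathrm{DOM}_t(G) \le \mathrm{DOM}_t(G-v)+1$.
   Context: All graphs are finite and simple. $\mathcal{C}$ denotes the class of all connected graphs that contain a cycle. An orientation of a graph $G$ is a digraph obtained by directing each edge $uv$ of $G$ in exactly one of the two directions $(u,v)$ or $(v,u)$. The orientation is valid if every vertex has in-degree at least $1$. A set $S\subseteq V(D)$ is a total dominating set of a digraph $D$ if every vertex of $D$ (including those in $S$) has an in-neighbor in $S$; $\gamma_t(D)$ is the minimum cardinality of a total dominating set of $D$. For a graph $G$ (not necessarily connected) $\mathrm{DOM}_t(G)$ is defined exactly when every component of $G$ contains a cycle (equivalently, $G$ has a valid orientation), and then it is the maximum of $\gamma_t(D)$ over all valid orientations $D$ of $G$. $G-v$ is the graph obtained from $G$ by deleting the vertex $v$ and all edges incident with it. *)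

(* Defs.v *)
From mathcomp Require Import all_boot.

Set Implicit Arguments.
Unset Strict Implicit.
Unset Printing Implicit Defensive.

Record sgraph := SGraph {
  svertex :> finType;
  sedge : rel svertex;
  sedge_sym : symmetric sedge;
  sedge_irr : irreflexive sedge
}.

Section Graph.
Variable G : sgraph.

(* The bound on the size rules out [:: x; y], a cycle of [sedge] in the sense
   of path.v as soon as x and y are adjacent. *)
Definition graph_cycle (s : seq G) : Prop :=
  2 < size s /\ ucycle (@sedge G) s.

Definition has_cycle_in (A : {set G}) : Prop :=
  exists s : seq G, graph_cycle s /\ {subset s <= A}.

Definition connected_graph : Prop := forall x y : G, connect (@sedge G) x y.

Definition component (x : G) : {set G} := [set y | connect (@sedge G) x y].

Definition class_C : Prop := connected_graph /\ has_cycle_in [set: G].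

Definition is_cycle_graph : Prop :=
  exists s : seq G,
    [/\ graph_cycle s,
        forall x : G, x \in s
      & forall x y : G, sedge x y = (y == next s x) || (x == next s y)].

End Graph.

Section DeleteVertex.
Variables (G : sgraph) (v : G).

Definition del_edge : rel {x : G | x != v} :=
  fun x y => sedge (val x) (val y).

Lemma del_edge_sym : symmetric del_edge.
Proof. by move=> x y; apply: sedge_sym. Qed.

Lemma del_edge_irr : irreflexive del_edge.
Proof. by move=> x; apply: sedge_irr. Qed.

Definition del_vertex : sgraph := SGraph del_edge_sym del_edge_irr.

End DeleteVertex.

(* A digraph on V is its set of arcs; (u, v) is the arc from u to v. *)
Section Digraph.
Variables (V : finType) (D : {set V * V}).

Definition in_neighbors (v : V) : {set V} := [set u | (u, v) \in D].

Definition total_dominating (S : {set V}) : bool :=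
  [forall v, exists u in S, u \in in_neighbors v].

(* Meaningful when every vertex has an in-neighbor, which is when [set: V] is
   total dominating. *)
Definition gamma_t : nat :=
  #|[arg min_(S < [set: V] | total_dominating S) #|S| ]|.

Lemma total_dominatingT :
  (forall v, 0 < #|in_neighbors v|) -> total_dominating [set: V].
Proof.
move=> D_valid; apply/forallP => v.
by have /card_gt0P[u uv] := D_valid v; apply/exists_inP; exists u.
Qed.

End Digraph.

Section Orientation.
Variable G : sgraph.

Definition orientation (D : {set G * G}) : bool :=
  [forall u, forall v,
     if sedge u v then ((u, v) \in D) (+) ((v, u) \in D)
     else (u, v) \notin D].

Definition valid_orientation (D : {set G * G}) : bool :=
  orientation D && [forall v, 0 < #|in_neighbors D v|].

Definition DOM_t_defined : Prop :=
  forall x : G, has_cycle_in (component x).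

(* The value is 0 when G has no valid orientation; it is meaningful only
   under [DOM_t_defined]. *)
Definition DOM_t : nat :=
  \max_(D : {set G * G} | valid_orientation D) gamma_t D.

End Orientation.

(* Main.v *)
Require Import Defs.
From mathcomp Require Import all_boot.

(** Let D be a valid orientation of G with the largest total domination number.
    If some vertex v is the unique in-neighbor of no vertex, then D restricted
    to G - v is still valid, so every component of G - v contains a cycle
    ([valid_orientation_DOM_t_defined]).  A total dominating set of the
    restriction, enlarged by one in-neighbor of v, is total dominating in D
    ([gamma_t_restrict]), which gives the inequality.

    Otherwise every vertex v is the unique in-neighbor of some vertex f v.
    Such an f is injective, hence bijective, hence every vertex has in-degree
    one and the arcs of D are exactly the pairs (v, f v): D is a disjoint union
    of directed cycles, and the connected graph G is a cycle
    ([private_out_neighbors_cycle]), which is excluded.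

    The orientation D exists because a connected graph with a cycle has a valid
    orientation ([class_C_valid_orientation]): orient the cycle cyclically and
    let every other vertex receive an arc from a vertex reached before it. *)

Set Implicit Arguments.
Unset Strict Implicit.
Unset Printing Implicit Defensive.

(** * Orientations and total domination *)

Section OrientationTheory.
Variables (G : sgraph) (D : {set G * G}).
Hypothesis D_or : orientation D.

Lemma orientation_edge u v : (u, v) \in D -> sedge u v.
Proof.
move: D_or => /forallP/(_ u)/forallP/(_ v); case: ifP => // _ /negP uvND uvD.
by case: uvND.
Qed.

Lemma orientation_asym u v : (u, v) \in D -> (v, u) \notin D.
Proof.
move=> uv; move: D_or => /forallP/(_ u)/forallP/(_ v).
by rewrite (orientation_edge uv) uv /=.
Qed.

Lemma orientation_total u v : sedge u v -> ((u, v) \in D) || ((v, u) \in D).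
Proof.
move=> uv; move: D_or => /forallP/(_ u)/forallP/(_ v).
by rewrite uv; case: (_ \in D).
Qed.

End OrientationTheory.

Section GammaT.
Variables (V : finType) (D : {set V * V}).

Lemma gamma_t_min S : total_dominating D S -> gamma_t D <= #|S|.
Proof.
move=> tdS; rewrite /gamma_t; case: arg_minnP => [|T _ minT]; last exact: minT.
apply/forallP=> v; have /forallP/(_ v)/exists_inP[u _ uv] := tdS.
by apply/exists_inP; exists u.
Qed.

Lemma gamma_t_witness :
  (forall v, 0 < #|in_neighbors D v|) ->
  exists2 S, total_dominating D S & #|S| = gamma_t D.
Proof.
move=> /total_dominatingT tdT; rewrite /gamma_t.
by case: arg_minnP => // S tdS _; exists S.
Qed.

End GammaT.

(** * Functions that never backtrack along edges *)

Lemma next_next_neq (T : eqType) (s : seq T) x :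
  uniq s -> 2 < size s -> x \in s -> next s (next s x) != x.
Proof.
move=> s_uniq s_gt2 /rot_to[i r rot_s].
have r_uniq : uniq (x :: r) by rewrite -rot_s rot_uniq.
have : 2 < size (x :: r) by rewrite -rot_s size_rot.
rewrite -!(next_rot i s_uniq) rot_s.
case: r r_uniq {rot_s} => [|y [|z r]] //= /and3P[].
rewrite !inE !negb_or => /and3P[xy xz _] _ _ _.
by rewrite eqxx [y == x]eq_sym (negbTE xy) eqxx eq_sym.
Qed.

Section ParentFunctions.
Variable G : sgraph.

(** [p x] stands for the tail of an arc entering [x]; the condition
    [p (p x) != x] is what allows these arcs to belong to one orientation. *)
Definition parent_on (A : {set G}) (p : G -> G) :=
  forall x, x \in A -> [/\ p x \in A, sedge x (p x) & p (p x) != x].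

(** A periodic point of a parent function lies on a graph cycle: irreflexivity
    and the absence of backtracking exclude the periods 1 and 2. *)
Lemma parent_orbit_cycle p x :
  parent_on setT p -> fcycle p (orbit p x) -> graph_cycle (orbit p x).
Proof.
move=> par cyc; have edge y : sedge y (p y) by case: (par y (in_setT y)).
split; last first.
  rewrite /ucycle orbit_uniq andbT; apply: (sub_cycle _ cyc) => y z /= /eqP <-.
  exact: edge.
have p_neq y : y != p y.
  by apply/eqP=> eq_y; have := edge y; rewrite -eq_y sedge_irr.
have [_ _ ppx] := par x (in_setT x).
apply: (@uniq_leq_size _ [:: x; p x; p (p x)]).
  by rewrite /= !inE !negb_or p_neq eq_sym ppx p_neq.
move=> y; rewrite -fconnect_orbit !inE => /or3P[] /eqP->.
- exact: connect0.
- exact: fconnect1.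
- exact: (fconnect_iter p 2).
Qed.

(** On a finite graph, following parents from [x] eventually repeats a vertex,
    and does so without leaving the component of [x]. *)
Lemma parent_component_cycle p (x : G) :
  parent_on setT p -> has_cycle_in (component x).
Proof.
move=> par.
(* The first repetition in the orbit of [x] exhibits a periodic point [y]. *)
have /trajectP[i lt_i eq_i] := looping_order p x.
pose y := iter i p x; pose m := order p x - i.
have m_gt0 : 0 < m by rewrite subn_gt0.
have yK : iter m p y = y.
  by rewrite /y /m -iterD subnK ?eq_i // ltnW.
have cyc_y : fcycle p (traject p y m).
  move: m_gt0 yK; case: (m) => // k _ yK.
  by rewrite /= -[X in rcons _ X]yK iterSr -trajectSr fpath_traject.
have y_in : y \in traject p y m by case: (m) m_gt0 => //= k _; rewrite mem_head.
exists (orbit p y); split.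
  exact: parent_orbit_cycle par (cycle_orbit_cycle cyc_y y_in).
move=> z; rewrite -fconnect_orbit inE => yz.
have subE : subrel (frel p) (connect (@sedge G)).
  move=> a b /= /eqP <-; apply: connect1.
  by case: (par a (in_setT a)).
by apply: (connect_sub subE); apply: connect_trans yz; apply: fconnect_iter.
Qed.

Lemma parent_valid_orientation p :
  parent_on setT p -> exists D : {set G * G}, valid_orientation D.
Proof.
move=> par; have edge y : sedge y (p y) by case: (par y (in_setT y)).
(* Edges that join no vertex to its parent are oriented by an arbitrary total
   order on the vertices. *)
exists [set e | sedge e.1 e.2 && ((p e.2 == e.1) ||
          (p e.1 != e.2) && (enum_rank e.1 < enum_rank e.2))].
apply/andP; split; last first.
  apply/forallP=> v; apply/card_gt0P; exists (p v).
  by rewrite !inE /= sedge_sym edge eqxx.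
apply/forallP=> u; apply/forallP=> v; rewrite !inE /= (sedge_sym v u).
case: ifP => [uv | ->] //=; rewrite uv /=.
have [pv|_] /= := eqVneq (p v) u.
  by case: (par v (in_setT v)) => _ _; rewrite pv => /negbTE->.
have [//|_] /= := eqVneq (p u) v.
case: ltngtP => // /val_inj/enum_rank_inj eq_uv.
by rewrite eq_uv sedge_irr in uv.
Qed.

Lemma graph_cycle_parent s : graph_cycle s -> parent_on [set x in s] (next s).
Proof.
case=> s_gt2 /andP[s_cyc s_uniq] x; rewrite !inE => xs; split.
- by rewrite mem_next.
- exact: next_cycle s_cyc xs.
- exact: next_next_neq.
Qed.

Lemma boundary_edge (A : {set G}) x :
  connected_graph G -> x \in A -> A != setT ->
  exists u w, [/\ u \in A, w \notin A & sedge u w].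
Proof.
move=> conn xA A_neqT.
case: (boolP [exists u, exists w, [&& u \in A, w \notin A & sedge u w]]).
  by move=> /existsP[u] /existsP[w] /and3P[]; exists u, w.
move=> /existsPn no_edge; case/eqP: A_neqT.
have closedA : closed (@sedge G) (mem A).
  apply: (intro_closed (sym_connect_sym (@sedge_sym G))).
  move=> u w uw uA; have /existsPn/(_ w) := no_edge u.
  by rewrite uA uw andbT negbK.
by apply/setP=> y; rewrite inE -(closed_connect closedA (conn x y)).
Qed.

(** A vertex adjacent to [A] takes its neighbor in [A] as parent; no
    backtracking arises because parents of vertices of [A] stay in [A]. *)
Lemma parent_extend (A : {set G}) p x :
  connected_graph G -> x \in A -> parent_on A p -> exists q, parent_on setT q.
Proof.
move=> conn; have [n] := ubnP #|~: A|; elim: n A p => // n IHn A p lt_n xA par.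
have [A_T|A_neqT] := eqVneq A setT; first by exists p; rewrite -A_T.
have [u [w [uA wNA uw]]] := boundary_edge conn xA A_neqT.
have neq_w y : y \in A -> (y == w) = false.
  by move=> yA; apply/eqP=> eq_y; rewrite -eq_y yA in wNA.
apply: (IHn (w |: A) (fun y => if y == w then u else p y)).
- rewrite -ltnS (leq_trans _ lt_n) // ltnS setCU setIC -setDE.
  by rewrite (cardsD1 w (~: A)) inE wNA.
- by rewrite inE xA orbT.
- move=> y; rewrite !inE; have [-> _|y_neq /= yA] := eqVneq y w.
    have [puA _ _] := par u uA.
    by rewrite uA orbT sedge_sym neq_w // neq_w.
  by have [pyA ypy ppy] := par y yA; rewrite pyA orbT neq_w.
Qed.

End ParentFunctions.

Lemma class_C_valid_orientation (G : sgraph) :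
  class_C G -> exists D : {set G * G}, valid_orientation D.
Proof.
case=> conn [s [s_cyc _]].
have [x xs] : exists x, x \in s.
  by case: s s_cyc => [[]//|x s _]; exists x; apply: mem_head.
have [|q] := parent_extend conn (x := x) _ (graph_cycle_parent s_cyc).
  by rewrite inE.
exact: parent_valid_orientation.
Qed.

Lemma valid_orientation_DOM_t_defined (G : sgraph) (D : {set G * G}) :
  valid_orientation D -> DOM_t_defined G.
Proof.
case/andP=> D_or /forallP D_in x.
have /fin_all_exists[p pD] : forall y, exists u, (u, y) \in D.
  by move=> y; have /card_gt0P[u] := D_in y; rewrite inE; exists u.
apply: (@parent_component_cycle _ p) => y _; split; first by rewrite inE.
  by rewrite sedge_sym (orientation_edge D_or).
(* If [p (p y)] were [y], both arcs between [y] and [p y] would be in [D]. *)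
apply/eqP=> ppy; have := orientation_asym D_or (pD y).
by rewrite -{1}ppy pD.
Qed.

(** * Deleting a vertex that is nobody's unique in-neighbor *)

Section Restriction.
Variables (G : sgraph) (D : {set G * G}) (v : G).
Hypothesis D_valid : valid_orientation D.

Definition restrict_orientation : {set del_vertex v * del_vertex v} :=
  [set e | (val e.1, val e.2) \in D].

Lemma restrict_valid :
  (forall w, in_neighbors D w != [set v]) ->
  valid_orientation restrict_orientation.
Proof.
move: D_valid => /andP[/forallP D_or /forallP D_in] not_private.
apply/andP; split; apply/forallP=> x.
  apply/forallP=> y; have /forallP/(_ (val y)) := D_or (val x).
  by rewrite !inE.
have [u ux uv] : exists2 u, u \in in_neighbors D (val x) & u != v.
  have /card_gt0P[w] := D_in (val x).
  have [->|w_neq wx] := eqVneq w v; last by exists w.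
  have := not_private (val x); rewrite eqEsubset sub1set => + vx.
  rewrite vx andbT => /subsetPn[u ux].
  by rewrite inE; exists u.
apply/card_gt0P; exists (Sub u uv : del_vertex v).
by move: ux; rewrite !inE SubK.
Qed.

Lemma gamma_t_restrict :
  valid_orientation restrict_orientation ->
  gamma_t D <= gamma_t restrict_orientation + 1.
Proof.
move=> /andP[_ /forallP/gamma_t_witness[S /forallP tdS <-]].
move: D_valid => /andP[_ /forallP/(_ v)/card_gt0P[u uv]].
apply: (@leq_trans #|u |: [set val y | y in S]|); last first.
  by rewrite addnC cardsU1 leq_add ?leq_b1 ?leq_imset_card.
apply/gamma_t_min/forallP=> w; apply/exists_inP.
have [->|w_neq] := eqVneq w v; first by exists u; rewrite ?setU11.
have /exists_inP[y yS yw] := tdS (Sub w w_neq).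
exists (val y); first by rewrite inE imset_f ?orbT.
by move: yw; rewrite !inE SubK.
Qed.

End Restriction.

(** * Orientations in which every vertex is a unique in-neighbor *)

Lemma private_out_neighbors_cycle (G : sgraph) (D : {set G * G}) (x : G) :
  connected_graph G -> orientation D ->
  (forall v, exists w, in_neighbors D w = [set v]) -> is_cycle_graph G.
Proof.
move=> conn D_or /fin_all_exists[f fP].
have f_inj : injective f.
  by move=> a b eq_f; apply: set1_inj; rewrite -!fP eq_f.
(* [f] is onto, so the in-neighborhood of every vertex is known. *)
have arcE a b : ((a, b) \in D) = (f a == b).
  have [g _ gK] := injF_bij f_inj.
  have := fP (g b); rewrite gK => /setP/(_ a); rewrite !inE => ->.
  by rewrite -{2}(gK b) (inj_eq f_inj).
have edgeE a b : sedge a b = (f a == b) || (f b == a).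
  apply/idP/orP; first by move/(orientation_total D_or); rewrite !arcE => /orP.
  rewrite -!arcE => -[|] /(orientation_edge D_or) //.
  by rewrite sedge_sym.
have par : parent_on setT f.
  move=> a _; rewrite inE edgeE eqxx; split=> //.
  by rewrite -arcE (orientation_asym D_or) // arcE.
have cyc : fcycle f (orbit f x) := cycle_orbit f_inj x.
have orbitT a : a \in orbit f x.
  rewrite -fconnect_orbit; apply: connect_sub (conn x a) => b c.
  rewrite edgeE => /orP[] /eqP <-; first exact: fconnect1.
  by rewrite fconnect_sym //; apply: fconnect1.
exists (orbit f x); split=> // [|a b]; first exact: parent_orbit_cycle.
by rewrite !(nextE cyc) // edgeE ![f _ == _]eq_sym.
Qed.

Theorem lemma2p10 (G : sgraph) (GC : class_C G) (GnC : ~ is_cycle_graph G) :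
  exists v : G,
    DOM_t_defined (del_vertex v) /\ DOM_t G <= DOM_t (del_vertex v) + 1.
Proof.
have [D0 D0_valid] := class_C_valid_orientation GC.
rewrite /DOM_t (bigmax_eq_arg D0) //.
case: arg_maxnP => // D D_valid _; have /andP[D_or _] := D_valid.
have [/existsP[v /forallP not_private]|all_private] :=
    boolP [exists v, forall w, in_neighbors D w != [set v]].
  have D'_valid := restrict_valid D_valid not_private.
  exists v; split; first exact: valid_orientation_DOM_t_defined D'_valid.
  apply: leq_trans (gamma_t_restrict D_valid D'_valid) _.
  by rewrite leq_add2r leq_bigmax_cond.
case: GnC; case: GC => conn [[|x s] [[//= _ _] _]].
apply: (private_out_neighbors_cycle x conn D_or) => v.
move/existsPn/(_ v)/forallPn: all_private => [w].
by rewrite negbK => /eqP; exists w.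
Qed.
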